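(* Let $\gamma>0$ be such that $\sigma\left(A\otimes I+I\otimes A+\frac{1}{\gamma^2}\sum_{k=1}^m N_k\otimes N_k\right)\subset\mathbb C_-$. Let $x_B$ be the solution of $$\dot x_B(t)=Ax_B(t)+Bu(t)+\sum_{k=1}^mN_kx_B(t)u_k(t),\quad x_B(0)=0,$$ let $P_B$ be a positive definite matrix satisfying $$A^\top P_B^{-1}+P_B^{-1}A+\frac1{\gamma^2}\sum_{k=1}^mN_k^\top P_B^{-1}N_k\le-P_B^{-1}BB^\top P_B^{-1},$$ and let $(p_{B,i})_{i=1,\ldots,n}$ be an orthonormal basis of $\mathbb R^n$ of eigenvectors of $P_B$. Then, for every $i$, $$\sup_{t\ge0}|\langle x_B(t),p_{B,i}\rangle_2|\le\lambda_{B,i}^{\frac12}\,\|u\|_{L^2}\exp\left(0.5\,\|\gamma u^0\|_{L^2}^2\right),$$ where $\lambda_{B,i}$ is the eigenvalue of $P_B$ associated with $p_{B,i}$.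
   Context: $A,N_1,\ldots,N_m\in\mathbb R^{n\times n}$, $B\in\mathbb R^{n\times m}$; $A$ is Hurwitz, i.e. $\sigma(A)\subset\mathbb C_-=\{z\in\mathbb C:\Re(z)<0\}$ ($\sigma(\cdot)$ is the spectrum). The control $u=(u_1,\ldots,u_m)^\top:[0,\infty)\to\mathbb R^m$ lies in $L^2$, with $\|f\|_{L^2}^2=\int_0^\infty\|f(s)\|_2^2\,ds$. The function $u^0=(u_1^0,\ldots,u_m^0)^\top$ is given by $u_k^0\equiv0$ if $N_k=0$ and $u_k^0=u_k$ otherwise. For symmetric matrices, $M_1\le M_2$ means $M_2-M_1$ is positive semidefinite. Positive definite means symmetric positive definite. *)

(* Defs.v *)
From HB Require Import structures.
From mathcomp Require Import all_boot all_order all_algebra.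
From mathcomp Require Import all_classical all_reals all_analysis.
From mathcomp Require Import complex mxtens.

Set Implicit Arguments.
Unset Strict Implicit.
Unset Printing Implicit Defensive.
Import Order.TTheory GRing.Theory Num.Theory.
Import numFieldNormedType.Exports.
Local Open Scope classical_set_scope.
Local Open Scope ring_scope.

Definition dot (R : realType) (n : nat) (v w : 'cV[R]_n) : R :=
  \sum_(i < n) v i 0 * w i 0.

Definition norm2 (R : realType) (n : nat) (v : 'cV[R]_n) : R :=
  Num.sqrt (dot v v).

Definition spectrum (R : realType) (n : nat) (M : 'M[R]_n) : set R[i] :=
  [set z | eigenvalue (map_mx (real_complex R) M) z].

Definition left_half_plane (R : realType) : set R[i] :=
  [set z | complex.Re z < 0].

Definition hurwitz (R : realType) (n : nat) (M : 'M[R]_n) : Prop :=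
  spectrum M `<=` @left_half_plane R.

Definition posdef (R : realType) (n : nat) (M : 'M[R]_n) : Prop :=
  M \is symmetricmx /\ forall v : 'cV[R]_n, v != 0 -> 0 < dot v (M *m v).

Definition possemidef (R : realType) (n : nat) (M : 'M[R]_n) : Prop :=
  M \is symmetricmx /\ forall v : 'cV[R]_n, 0 <= dot v (M *m v).

Definition loewner_le (R : realType) (n : nat) (M1 M2 : 'M[R]_n) : Prop :=
  possemidef (M2 - M1).

Definition orthonormal_basis (R : realType) (n : nat)
    (p : 'I_n -> 'cV[R]_n) : Prop :=
  basis_of fullv [tuple p i | i < n] /\
  forall i j : 'I_n, dot (p i) (p j) = (i == j)%:R.

(* Functions on [0, oo[ are represented by functions on R; only their
   restriction to [0, oo[ matters. *)
Definition in_L2 (R : realType) (n : nat) (f : R -> 'cV[R]_n) : Prop :=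
  (forall i : 'I_n, measurable_fun (`[0, +oo[ : set R) (fun s : R => f s i 0)) /\
  (\int[lebesgue_measure]_(s in `[0%R, +oo[) (norm2 (f s) ^+ 2)%:E < +oo)%E.

Definition L2norm (R : realType) (n : nat) (f : R -> 'cV[R]_n) : R :=
  Num.sqrt (\int[lebesgue_measure]_(s in `[0, +oo[) (norm2 (f s) ^+ 2)).

Definition bilinear_rhs (R : realType) (n m : nat) (A : 'M[R]_n)
    (B : 'M[R]_(n, m)) (N : 'I_m -> 'M[R]_n) (x : 'cV[R]_n) (u : 'cV[R]_m) :
    'cV[R]_n :=
  A *m x + B *m u + \sum_(k < m) u k 0 *: (N k *m x).

(* Solutions in the sense of Caratheodory: as the control is only square
   integrable, the differential equation with x(0) = x0 means that x satisfies
   the corresponding integral equation on [0, oo[. Integrability has to be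
   required because the integral of a non-integrable function is a default
   value. *)
Definition bilinear_solution (R : realType) (n m : nat) (A : 'M[R]_n)
    (B : 'M[R]_(n, m)) (N : 'I_m -> 'M[R]_n) (u : R -> 'cV[R]_m)
    (x0 : 'cV[R]_n) (x : R -> 'cV[R]_n) : Prop :=
  forall (t : R) (i : 'I_n), 0 <= t ->
    lebesgue_measure.-integrable `[0, t]
      (fun s => (bilinear_rhs A B N (x s) (u s) i 0)%:E) /\
    x t i 0 = x0 i 0 +
      \int[lebesgue_measure]_(s in `[0, t]) bilinear_rhs A B N (x s) (u s) i 0.

Definition active_control (R : realType) (n m : nat) (N : 'I_m -> 'M[R]_n)
    (u : R -> 'cV[R]_m) (s : R) : 'cV[R]_m :=
  \col_(k < m) (if N k == 0 then 0 else u s k 0).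

(* Main.v *)
(* With Q = P_B^-1, the energy V = <x_B, Q x_B> is absolutely continuous and,
   by the matrix inequality and completion of squares, satisfies
   V' <= |u|^2 + |gamma u^0|^2 V. Gronwall bounds V by
   |u|_{L^2}^2 exp(|gamma u^0|_{L^2}^2), and <x_B, p_i>^2 <= lambda_i V because
   p_i is an eigenvector of Q. Absolute continuity is only ever used through
   integral representations. *)
Require Import Defs.
From HB Require Import structures.
From mathcomp Require Import all_boot all_order all_algebra.
From mathcomp Require Import all_classical all_reals all_analysis.
From mathcomp Require Import complex mxtens.
From mathcomp Require Import measurable_realfun ring lra.

Set Implicit Arguments.
Unset Strict Implicit.
Unset Printing Implicit Defensive.
Import Order.TTheory GRing.Theory Num.Theory.
Import numFieldNormedType.Exports.
Local Open Scope classical_set_scope.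
Local Open Scope ring_scope.

(** * Indefinite Lebesgue integrals on the half-line and their product rule *)

Section Primitive.
Context {R : realType}.
Notation mu := (@lebesgue_measure R).
Implicit Types (F G f g : R -> R) (t T c : R).

(** Encodes that [F] is absolutely continuous on compact intervals, vanishes at [0] and has density
    [f]. Integrability is demanded because the integral of a non-integrable function is a default
    value. *)
Definition is_primitive F f : Prop := forall t, 0 <= t ->
  mu.-integrable `[0, t] (EFin \o f) /\ F t = \int[mu]_(s in `[0, t]) f s.

Lemma eq_primitive F f f' : (forall t, 0 <= t -> f t = f' t) ->
  is_primitive F f -> is_primitive F f'.
Proof.
move=> ff' Ff t t0; have [ft ->] := Ff t t0.
have ff't : {in `[0, t]%classic, f =1 f'}.
  by move=> s; rewrite inE/= in_itv/= => /andP[s0 _]; exact: ff'.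
split; last exact: eq_Rintegral.
by apply: eq_integrable ft => //= s st /=; rewrite ff't.
Qed.

Lemma is_primitiveD F G f g : is_primitive F f -> is_primitive G g ->
  is_primitive (F \+ G) (f \+ g).
Proof.
move=> Ff Gg t t0; have [ft FE] := Ff t t0; have [gt GE] := Gg t t0.
split; last by rewrite /= FE GE RintegralD.
by rewrite (_ : EFin \o _ = (EFin \o f) \+ (EFin \o g))%E//; exact: integrableD.
Qed.

Lemma is_primitiveZ c F f : is_primitive F f ->
  is_primitive (fun t => c * F t) (fun t => c * f t).
Proof.
move=> Ff t t0; have [ft FE] := Ff t t0; split; last by rewrite FE RintegralZl.
rewrite (_ : EFin \o _ = fun s => (c%:E * (EFin \o f) s)%E)//.
exact: integrableZl.
Qed.

Lemma is_primitive_sum n (F f : 'I_n -> R -> R) :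
  (forall i, is_primitive (F i) (f i)) ->
  is_primitive (fun t => \sum_(i < n) F i t) (fun t => \sum_(i < n) f i t).
Proof.
elim: n F f => [F f _|n IH F f Ff].
  have sum0 (h : 'I_0 -> R -> R) : (fun t => \sum_(i < 0) h i t) = cst 0.
    by apply/funext => t; rewrite big_ord0.
  rewrite !sum0 => t t0; split; first exact: integrable0.
  by rewrite Rintegral_cst// mul0r.
have sumS (h : 'I_n.+1 -> R -> R) : (fun t => \sum_(i < n.+1) h i t) =
    (fun t => \sum_(i < n) h (widen_ord (leqnSn n) i) t) \+ h ord_max.
  by apply/funext => t; rewrite big_ord_recr.
by rewrite !sumS; apply: is_primitiveD => //; exact: IH.
Qed.

Lemma is_primitive_continuous F f t : 0 <= t -> is_primitive F f ->
  {within `[0, t], continuous F}.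
Proof.
move=> t0 Ff; have [ft _] := Ff t t0.
apply: subspace_eq_continuous (parameterized_integral_continuous t0 ft).
move=> s; rewrite inE/= in_itv/= => /andP[s0 _].
by rewrite /from_subspace/= /parameterized_integral (Ff s s0).2.
Qed.

Lemma is_primitive_measurable F f t : 0 <= t -> is_primitive F f ->
  measurable_fun `[0, t] F.
Proof.
move=> t0 /(is_primitive_continuous t0) cF.
exact: subspace_continuous_measurable_fun cF.
Qed.

Lemma le_is_primitive F G f g t : is_primitive F f -> is_primitive G g ->
  0 <= t -> (forall s, 0 <= s <= t -> f s <= g s) -> F t <= G t.
Proof.
move=> Ff Gg t0 fg; have [ft ->] := Ff t t0; have [gt ->] := Gg t t0.
by apply: le_Rintegral => // s /=; rewrite in_itv; exact: fg.
Qed.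

Lemma is_primitive_nondecreasing F f s t : is_primitive F f ->
  (forall r, 0 <= r -> 0 <= f r) -> 0 <= s <= t -> F s <= F t.
Proof.
move=> Ff f0 /andP[s0 st]; have t0 := le_trans s0 st.
have [fs ->] := Ff s s0; have [ft ->] := Ff t t0.
rewrite fine_le//; try exact: integrable_fin_num.
apply: ge0_subset_integral => //.
- by case/integrableP : ft.
- by move=> r /=; rewrite in_itv/= lee_fin => /andP[/f0].
- by apply: subset_itvl; rewrite bnd_simp.
Qed.

(** The bound is the integral of [|f|] over [[0, t]], which is nondecreasing in its upper limit. *)
Lemma is_primitive_bounded F f t : 0 <= t -> is_primitive F f ->
  exists2 M : R, 0 <= M & forall s : R, 0 <= s <= t -> `|F s| <= M.
Proof.
move=> t0 Ff; pose H s := \int[mu]_(r in `[0, s]) `|f r|.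
have Hf : is_primitive H (Num.norm \o f).
  move=> s s0; split => //; have [fs _] := Ff s s0.
  rewrite (_ : EFin \o _ = abse \o (EFin \o f))//; exact: integrable_abse.
exists (H t); first exact: Rintegral_ge0.
move=> s /[dup] /andP[s0 _] st; have [fs FE] := Ff s s0.
apply: le_trans (is_primitive_nondecreasing Hf _ st) => [|r _ /=] //.
by rewrite FE; exact: le_normr_Rintegral.
Qed.

(** On [[0, t]] a primitive is measurable and bounded by some [M], so [M * |g|] dominates the
    product. *)
Lemma integrable_mul_primitive F f g t : 0 <= t -> is_primitive F f ->
  mu.-integrable `[0, t] (EFin \o g) ->
  mu.-integrable `[0, t] (EFin \o (fun s => F s * g s)).
Proof.
move=> t0 Ff gt; have [M M0 FM] := is_primitive_bounded t0 Ff.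
have mg : measurable_fun `[0, t] g by case/integrableP : gt => /measurable_EFinP.
apply: (le_integrable _ _ _ (integrableZl _ M gt)) => //.
- by apply/measurable_EFinP; apply: measurable_funM => //;
    exact: is_primitive_measurable t0 Ff.
- move=> s /=; rewrite in_itv/= => /FM FsM.
  by rewrite lee_fin !normrM (ger0_norm M0) ler_wpM2r.
Qed.

(* Integrating [f s * g r] over the triangle [s < r] in either order is all
   there is to the product rule; no differentiability is involved. *)
Lemma is_primitiveM F G f g : is_primitive F f -> is_primitive G g ->
  is_primitive (fun t => F t * G t) (fun t => G t * f t + F t * g t).
Proof.
move=> Ff Gg t t0; have [ft Ft] := Ff t t0; have [gt Gt] := Gg t t0.
have iGf := integrable_mul_primitive t0 Gg ft.
have iFg := integrable_mul_primitive t0 Ff gt.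
split.
  rewrite (_ : EFin \o _ =
    ((EFin \o (fun s => (G s * f s)%R)) \+ (EFin \o (fun s => (F s * g s)%R)))%E)//.
  exact: integrableD.
(* Extension by zero outside [[0, t]] allows Fubini's theorem to be applied on the whole plane. *)
pose f' := f \_ `[0, t]; pose g' := g \_ `[0, t].
have if' : mu.-integrable setT (EFin \o f').
  by rewrite -restrict_EFin; apply/integrable_restrict => //=; rewrite setTI.
have ig' : mu.-integrable setT (EFin \o g').
  by rewrite -restrict_EFin; apply/integrable_restrict => //=; rewrite setTI.
have mf' : measurable_fun setT f' by case/integrableP : if' => /measurable_EFinP.
have mg' : measurable_fun setT g' by case/integrableP : ig' => /measurable_EFinP.
pose h (z : R * R) : R := if z.1 < z.2 then f' z.1 * g' z.2 else 0.
have mh : measurable_fun setT h.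
  apply: measurable_fun_ifT.
  - exact: measurable_fun_ltr.
  - by apply: measurable_funM; exact: measurableT_comp.
  - exact: measurable_cst.
(* The L1 norm is named as a real constant so that it can be pulled out of an outer integral. *)
have iabs k : mu.-integrable setT (EFin \o k) ->
    exists2 c : R, (\int[mu]_y `|(EFin \o k) y| = c%:E)%E &
      mu.-integrable setT (fun y => `|(EFin \o k) y|)%E.
  move=> /integrable_abse ik; exists (fine (\int[mu]_y `|(EFin \o k) y|)%E) => //.
  by rewrite fineK//; exact: integrable_fin_num.
(* [h] is dominated by the tensor product of [f'] and [g'], whose iterated absolute integral is the
   product of the two L1 norms. *)
have ih : (mu \x mu)%E.-integrable setT (EFin \o h).
  suff ifg : (mu \x mu)%E.-integrable setT (EFin \o (fun z => f' z.1 * g' z.2)).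
    apply: (le_integrable _ _ _ ifg) => //; first exact/measurable_EFinP.
    by move=> [x y] _; rewrite /h /= lee_fin; case: ifP => // _; rewrite normr0.
  apply/integrable12ltyP => /=.
    by apply/measurable_EFinP/measurable_funM; exact: measurableT_comp.
  have [c gc ig] := iabs _ ig'; have [d fd iff] := iabs _ if'.
  under eq_integral => x _.
    under eq_integral do rewrite normrM EFinM.
    rewrite integralZl//= gc; over.
  by rewrite integralZr//= fd -EFinM ltry.
have := Fubini ih.
(* Integrating over the second variable first leaves [f s] times the increment of [G] from [s] to
   [t]. *)
have -> : (fun x => \int[mu]_y (EFin \o h) (x, y))%E =
    (EFin \o (fun s => G t * f s - G s * f s)) \_ `[0, t].
  apply/funext => s; rewrite patchE; case: ifPn; last first.
    move=> st; rewrite integral0_eq// => r _ /=.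
    by rewrite /h/= /f' patchE (negPf st) mul0r if_same.
  rewrite inE/= in_itv/= => /andP[s0 st].
  transitivity (\int[mu]_(r in `]s, t]) (f s * g r)%:E)%E.
    rewrite [RHS]integral_mkcond; apply: eq_integral => r _ /=.
    rewrite /h /= /f' /g' !patchE !mem_setE !in_itv/= s0 st /=.
    case: (ltP s r) => sr //=.
    by rewrite (le_trans s0 (ltW sr))/=; case: ifPn; rewrite ?mulr0.
  have igs : mu.-integrable `]s, t] (EFin \o g).
    by apply: integrableS gt => //; apply: subset_itvr; rewrite bnd_simp.
  under eq_integral do rewrite EFinM.
  rewrite integralZl//= -[X in (_ * X)%E]fineK; last exact: integrable_fin_num igs.
  have := @Rintegral_itvB _ g (BLeft 0) (BRight t) s gt.
  rewrite !bnd_simp s0 st -Gt -(Gg s s0).2 => /(_ isT isT) GE.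
  by rewrite -EFinM -/(Rintegral _ _ _) -GE mulrC mulrBl.
(* Integrating over the first variable first leaves [g] times [F]; the strict inequality in [h]
   gives a right-open interval, whose missing endpoint has measure zero. *)
have -> : (fun y => \int[mu]_x (EFin \o h) (x, y))%E =
    (EFin \o (fun s => F s * g s)) \_ `[0, t].
  apply/funext => r; rewrite patchE; case: ifPn; last first.
    move=> rt; rewrite integral0_eq// => s _ /=.
    by rewrite /h/= /g' patchE (negPf rt) mulr0 if_same.
  rewrite inE/= in_itv/= => /andP[r0 rt].
  transitivity (\int[mu]_(s in `[0%R, r[) (f s * g r)%:E)%E.
    rewrite [RHS]integral_mkcond; apply: eq_integral => s _ /=.
    rewrite /h /= /f' /g' !patchE !mem_setE !in_itv/= r0 rt /=.
    case: (ltP s r) => sr //=; last by rewrite andbF.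
    by rewrite (le_trans (ltW sr) rt) !andbT; case: ifPn; rewrite ?mul0r.
  have ifr : mu.-integrable `[0, r[ (EFin \o f).
    apply: integrableS (Ff r r0).1 => //.
    by apply: subset_itvl; rewrite bnd_simp.
  under eq_integral do rewrite EFinM.
  rewrite integralZr//= -[X in (X * _)%E]fineK; last exact: integrable_fin_num ifr.
  by rewrite -EFinM -/(Rintegral _ _ _) Rintegral_itv_bndo_bndc// -(Ff r r0).2.
(* Fubini now reads [G t * F t - \int G f = \int F g], which only has to be rearranged. *)
rewrite -!integral_mkcond => /(congr1 fine).
rewrite -!/(Rintegral _ _ _) RintegralB//; last 1 first.
  rewrite (_ : EFin \o _ = fun s => ((G t)%:E * (EFin \o f) s)%E)//.
  exact: integrableZl.
rewrite RintegralZl// -Ft => /eqP; rewrite subr_eq => /eqP.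
by rewrite RintegralD// mulrC => ->; rewrite addrC.
Qed.

(** * Terms of the exponential series and Gronwall's inequality *)

Lemma exp_coeff0n (x : R) : exp_coeff x 0 = 1.
Proof. by rewrite /exp_coeff/= expr0 fact0 divr1. Qed.

Lemma exp_coeffS (x : R) n : exp_coeff x n.+1 = n.+1%:R^-1 * (x * exp_coeff x n).
Proof.
by rewrite /exp_coeff/= factS natrM exprS; field; rewrite nat1r !pnatr_eq0 -lt0n fact_gt0.
Qed.

(** The chain rule for [F^(k+1) / (k+1)!], obtained from the product rule by induction on [k]. *)
Lemma is_primitive_exp_coeff F f k : is_primitive F f ->
  is_primitive (fun t => exp_coeff (F t) k.+1) (fun t => f t * exp_coeff (F t) k).
Proof.
move=> Ff; elim: k => [|k IH].
  rewrite (_ : (fun t => exp_coeff _ _) = F); last first.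
    by apply/funext => t; rewrite exp_coeffS exp_coeff0n mulr1 invr1 mul1r.
  by apply: eq_primitive Ff => t _; rewrite exp_coeff0n mulr1.
rewrite (_ : (fun t => exp_coeff _ k.+2) =
    fun t => k.+2%:R^-1 * (F t * exp_coeff (F t) k.+1)); last first.
  by apply/funext => t; rewrite exp_coeffS.
(* Since [F] times the [k]-th term is [k+1] times the next one, the product rule yields [k+2] equal
   contributions, which the prefactor cancels. *)
apply: eq_primitive (is_primitiveZ k.+2%:R^-1 (is_primitiveM Ff IH)) => t _.
by rewrite exp_coeffS; field; rewrite nat1r -natrD !pnatr_eq0.
Qed.

(* Picard iteration: substituting the [n]-th bound into the integral inequality
   [V <= alpha + \int b V] produces the [n+1]-st one. *)
Lemma gronwall V w alpha a beta b t :
  is_primitive V w -> is_primitive alpha a -> is_primitive beta b ->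
  (forall s, 0 <= s -> 0 <= a s) -> (forall s, 0 <= s -> 0 <= b s) ->
  (forall s, 0 <= s -> w s <= a s + b s * V s) ->
  0 <= t -> V t <= alpha t * expR (beta t).
Proof.
move=> Vw alphaa betab a0 b0 wab t0.
have [M M0 VM] := is_primitive_bounded t0 Vw.
pose S n x := \sum_(k < n) exp_coeff x k : R.
(* The factor [alpha t] is frozen at the final time, so that it stays constant under integration;
   [M] bounds [V] and starts the iteration. *)
have key n s : 0 <= s <= t ->
    V s <= alpha t * S n (beta s) + M * exp_coeff (beta s) n.
  elim: n s => [|n IH] s st.
    rewrite /S big_ord0 mulr0 add0r exp_coeff0n mulr1.
    exact: le_trans (ler_norm _) (VM s st).
  (* The shifted index reflects that each integration against [b] raises the degree in [beta] by
     one. *)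
  pose e k := fun s => exp_coeff (beta s) k.+1.
  have eb k : is_primitive (e k) (fun s => b s * exp_coeff (beta s) k).
    exact: is_primitive_exp_coeff.
  have Hb := is_primitiveD alphaa (is_primitiveD
    (is_primitiveZ (alpha t) (is_primitive_sum (fun k : 'I_n => eb k)))
    (is_primitiveZ M (eb n))).
  have s0 : 0 <= s by case/andP : st.
  apply: le_trans (le_is_primitive Vw Hb s0 _) _ => [r /andP[r0 rs]|] /=.
    apply: le_trans (wab r r0) _; rewrite lerD2l -mulr_sumr.
    rewrite mulrCA (mulrCA M) -mulrDr ler_wpM2l ?b0//; apply: IH.
    by case/andP : st => _; rewrite r0 => /(le_trans rs).
  (* The term of degree [0] in the new partial sum absorbs [alpha s], because [alpha] is
     nondecreasing. *)
  rewrite addrA lerD2r /S big_ord_recl mulrDr.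
  rewrite exp_coeff0n mulr1 lerD2r.
  exact: is_primitive_nondecreasing alphaa a0 st.
(* The partial sums tend to the exponential, and the remainder, a single term of a convergent
   series, tends to [0]. *)
have cvgb : alpha t * S n (beta t) + M * exp_coeff (beta t) n @[n --> \oo] -->
    alpha t * expR (beta t) + M * 0.
  apply: cvgD; last by apply: cvgMr; exact: cvg_exp_coeff.
  apply: cvgMr; rewrite (_ : (fun n => _) = series (exp_coeff (beta t))).
    exact: is_cvg_series_exp_coeff.
  by apply/funext => n; rewrite /series/= big_mkord.
rewrite mulr0 addr0 in cvgb.
apply: (cvgr_to_ge cvgb); apply: nearW => n.
by apply: key; rewrite t0 lexx.
Qed.

End Primitive.

(** * The Euclidean inner product and positive definite forms *)

Section Dot.
Context {R : realType}.
Implicit Types n m : nat.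

Lemma dotC n (v w : 'cV[R]_n) : dot v w = dot w v.
Proof. by apply: eq_bigr => i _; rewrite mulrC. Qed.

Lemma dotDr n (v w z : 'cV[R]_n) : dot v (w + z) = dot v w + dot v z.
Proof. by rewrite -big_split; apply: eq_bigr => i _; rewrite mxE mulrDr. Qed.

Lemma dotZr n a (v w : 'cV[R]_n) : dot v (a *: w) = a * dot v w.
Proof. by rewrite mulr_sumr; apply: eq_bigr => i _; rewrite mxE mulrCA. Qed.

Lemma dot0r n (v : 'cV[R]_n) : dot v 0 = 0.
Proof. by apply: big1 => i _; rewrite mxE mulr0. Qed.

Lemma dotNr n (v w : 'cV[R]_n) : dot v (- w) = - dot v w.
Proof. by rewrite -scaleN1r dotZr mulN1r. Qed.

Lemma dot_sumr n k (v : 'cV[R]_n) (w : 'I_k -> 'cV[R]_n) :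
  dot v (\sum_i w i) = \sum_i dot v (w i).
Proof.
rewrite exchange_big; apply: eq_bigr => i _.
by rewrite summxE mulr_sumr.
Qed.

Lemma dot_mulmx n m (M : 'M[R]_(n, m)) v w :
  dot v (M *m w) = dot (M^T *m v) w.
Proof.
have dotE k (a b : 'cV[R]_k) : dot a b = (a^T *m b) 0 0.
  by rewrite mxE; apply: eq_bigr => i _; rewrite mxE.
by rewrite !dotE trmx_mul trmxK mulmxA.
Qed.

Lemma dot_ge0 n (v : 'cV[R]_n) : 0 <= dot v v.
Proof. by apply: sumr_ge0 => i _; rewrite -expr2 sqr_ge0. Qed.

Lemma norm2_sqr n (v : 'cV[R]_n) : norm2 v ^+ 2 = dot v v.
Proof. by rewrite sqr_sqrtr// dot_ge0. Qed.

Lemma symmetricmx_tr n (M : 'M[R]_n) : M \is symmetricmx -> M^T = M.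
Proof. by move=> /is_hermitianmxP {2}->; rewrite expr0 scale1r map_mx_id. Qed.

(** A nonzero kernel vector would make the quadratic form vanish; symmetry turns the row kernel into
    a column kernel. *)
Lemma posdef_unitmx n (P : 'M[R]_n) : posdef P -> P \in unitmx.
Proof.
case=> /symmetricmx_tr sP P0; rewrite -row_free_unit -kermx_eq0.
apply/negPn/negP => /rowV0Pn[v /sub_kermxP vP v0].
have /P0 : v^T != 0 by rewrite trmx_eq0.
have -> : P *m v^T = 0 by rewrite -[P]sP -trmx_mul vP trmx0.
by rewrite dot0r ltxx.
Qed.

(** Writing [v = P w], the form of the inverse at [v] is the form of [P] at [w]. *)
Lemma posdef_inv n (P : 'M[R]_n) : posdef P -> possemidef (invmx P).
Proof.
move=> hP; have uP := posdef_unitmx hP; case: hP => sP P0; split.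
  apply/is_hermitianmxP; rewrite expr0 scale1r map_mx_id//.
  by rewrite trmx_inv (symmetricmx_tr sP).
move=> v; rewrite -{1}[v](mulKVmx uP) dotC.
have [->|/P0/ltW//] := eqVneq (invmx P *m v) 0.
by rewrite mulmx0 dot0r.
Qed.

(* The square of [x - <x,p> p] in the form [P^-1], which [p] diagonalizes, is
   nonnegative. *)
Lemma dot_eigenvector_le n (P : 'M[R]_n) (l : R) (x p : 'cV[R]_n) :
  posdef P -> P *m p = l *: p -> dot p p = 1 ->
  0 < l /\ dot x p ^+ 2 <= l * dot x (invmx P *m x).
Proof.
move=> hP Pp pp; have uP := posdef_unitmx hP.
have [/symmetricmx_tr sQ Q0] := posdef_inv hP.
have l0 : 0 < l.
  have p0 : p != 0.
    by apply: contra_eq_neq pp => ->; rewrite dot0r eq_sym oner_eq0.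
  by have := hP.2 p p0; rewrite Pp dotZr pp mulr1.
split=> //; have Qp : invmx P *m p = l^-1 *: p.
  by rewrite -[X in _ *: X](mulKmx uP) Pp -scalemxAr scalerA mulVf ?scale1r ?gt_eqF.
have pQx : dot p (invmx P *m x) = l^-1 * dot x p.
  by rewrite dot_mulmx sQ Qp dotC dotZr.
(* Each cross term contributes [- l^-1 * dot x p ^+ 2], and the square of the subtracted part
   cancels one of the two. *)
have := Q0 (x + (- dot x p) *: p).
rewrite mulmxDr -scalemxAr !(dotC (x + _)) !dotDr !dotZr.
rewrite !(dotC (_ + _)) !dotDr !dotZr pQx Qp !dotZr pp.
move=> H; rewrite -ler_pdivrMl// expr2; lra.
Qed.

End Dot.

(** * Energy dissipation and square-integrable controls *)

Section Energy.
Context {R : realType}.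
Notation mu := (@lebesgue_measure R).

Lemma is_primitive_quad n (Q : 'M[R]_n) (x f : R -> 'cV[R]_n) :
  (forall i, is_primitive (fun t => x t i 0) (fun t => f t i 0)) ->
  is_primitive (fun t => dot (x t) (Q *m x t))
    (fun t => dot (Q *m x t) (f t) + dot (x t) (Q *m f t)).
Proof.
move=> xf; have Qxf i : is_primitive (fun t => (Q *m x t) i 0)
    (fun t => (Q *m f t) i 0).
  rewrite (_ : (fun t => (Q *m x t) i 0) = fun t => \sum_j Q i j * x t j 0).
    apply: eq_primitive (is_primitive_sum (fun j => is_primitiveZ _ (xf j))).
    by move=> t _; rewrite mxE.
  by apply/funext => t; rewrite mxE.
apply: eq_primitive (is_primitive_sum (fun i => is_primitiveM (xf i) (Qxf i))).
by move=> t _; rewrite big_split.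
Qed.

(** Young's inequality splits the input term and each bilinear term; the parts free of [u], together
    with the drift term, form the expression that the matrix inequality makes nonpositive. *)
Lemma lmi_dissipation n m (A Q : 'M[R]_n) (B : 'M[R]_(n, m)) N (g : R)
    (u : R -> 'cV[R]_m) s (x : 'cV[R]_n) :
  g != 0 -> possemidef Q ->
  loewner_le (A^T *m Q + Q *m A + g ^- 2 *: \sum_(k < m) (N k)^T *m Q *m N k)
    (- (Q *m B *m B^T *m Q)) ->
  2 * dot x (Q *m bilinear_rhs A B N x (u s)) <=
    norm2 (u s) ^+ 2 +
    norm2 (g *: active_control N u s) ^+ 2 * dot x (Q *m x).
Proof.
move=> g0 [/symmetricmx_tr sQ Q0] [_ /(_ x)].
set y := B^T *m (Q *m x).
have BB : dot x (Q *m B *m B^T *m Q *m x) = dot y y.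
  by rewrite -!mulmxA dot_mulmx sQ dot_mulmx.
have AQ : dot x (A^T *m Q *m x) = dot x (Q *m (A *m x)).
  by rewrite -mulmxA dot_mulmx trmxK dotC [RHS]dot_mulmx sQ.
have NQN k : dot x ((N k)^T *m Q *m N k *m x) = dot (N k *m x) (Q *m (N k *m x)).
  by rewrite -!mulmxA dot_mulmx trmxK.
rewrite mulmxBl mulNmx !mulmxDl -scalemxAl mulmx_suml dotDr !dotNr !dotDr dotZr.
rewrite BB AQ -(mulmxA Q A) dot_sumr (eq_bigr _ (fun k _ => NQN k)) mulr_sumr.
move=> lmi.
(* Expansion of the square of [u s - y]. *)
have uy : 2 * dot x (Q *m (B *m u s)) <= dot (u s) (u s) + dot y y.
  rewrite (dot_mulmx Q) sQ dot_mulmx -/y.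
  have := dot_ge0 (u s - y); rewrite dotDr dotNr !(dotC (u s - y)) !dotDr !dotNr.
  by rewrite (dotC (u s) y); move: (dot y y) (dot y _) (dot (u s) _) => *; lra.
have uN : 2 * dot x (Q *m \sum_(k < m) u s k 0 *: (N k *m x)) <=
    \sum_(k < m) g ^- 2 * dot (N k *m x) (Q *m (N k *m x)) +
    dot (g *: active_control N u s) (g *: active_control N u s) * dot x (Q *m x).
  rewrite mulmx_sumr dot_sumr mulr_sumr mulr_suml -big_split/=.
  apply: ler_sum => k _; rewrite !mxE -scalemxAr dotZr.
  (* Both sides vanish when [N k] is zero, which is why the active control suffices on the right. *)
  have [->|Nk0] := eqVneq (N k) 0.
    by rewrite mul0mx mulmx0 !dot0r !mulr0 mul0r addr0 lexx.
  set z := N k *m x; set v := u s k 0.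
  (* The weights [g] and [g^-1] make the cross term free of [g] and produce the factor [g ^- 2] of
     the matrix inequality. *)
  pose w := (g * v) *: x - g^-1 *: z.
  have wl d : dot w d = g * v * dot x d - g^-1 * dot z d.
    by rewrite dotC dotDr dotNr !dotZr !(dotC d).
  have zx : dot z (Q *m x) = dot x (Q *m z).
    by rewrite dotC [RHS]dot_mulmx sQ.
  have := Q0 w; rewrite [in Q *m w]/w mulmxBr -!scalemxAr dotDr dotNr !dotZr !wl zx.
  have gg : g * g^-1 = 1 by rewrite divff.
  have -> : g ^- 2 = g^-1 * g^-1 by rewrite expr2 invfM.
  set a := dot x _; set b := dot x _; set c := dot z _ => H.
  (* The cross terms in [H] carry the factor [g * g^-1]; inserting it in the goal leaves a linear
     problem in the same monomials. *)
  suff -> : 2 * (v * b) = (g * g^-1) * (2 * (v * b)) by lra.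
  by rewrite gg mul1r.
rewrite /bilinear_rhs !mulmxDr !dotDr !norm2_sqr.
move: lmi uy uN; move: (dot y y) (dot x _) (dot x _) (dot x _) (dot x _).
move: (dot (u s) _) (dot (_ *: _) _) (\sum_(k < m) _) => *; lra.
Qed.

Lemma measurable_norm2_sqr n (D : set R) (f : R -> 'cV[R]_n) :
  (forall i, measurable_fun D (fun s => f s i 0)) ->
  measurable_fun D (fun s => norm2 (f s) ^+ 2).
Proof.
move=> mf; rewrite (_ : (fun s => _) = fun s => \sum_i f s i 0 * f s i 0).
  by apply: measurable_sum => i; apply: measurable_funM; exact: mf.
by apply/funext => s; rewrite norm2_sqr.
Qed.

Lemma in_L2_integrable n (f : R -> 'cV[R]_n) : in_L2 f ->
  mu.-integrable `[0, +oo[ (EFin \o (fun s => norm2 (f s) ^+ 2)).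
Proof.
move=> [mf foo]; apply/integrableP; split.
  by apply/measurable_EFinP; exact: measurable_norm2_sqr mf.
by under eq_integral do rewrite gee0_abs ?lee_fin ?sqr_ge0//.
Qed.

(** Componentwise, the squared norm is dominated by [g ^+ 2] times that of [u]. *)
Lemma in_L2_active n m (N : 'I_m -> 'M[R]_n) (g : R) (u : R -> 'cV[R]_m) :
  in_L2 u -> in_L2 (fun s => g *: active_control N u s).
Proof.
move=> hu; have mgu k : measurable_fun (`[0, +oo[ : set R)
    (fun s => (g *: active_control N u s) k 0).
  rewrite (_ : (fun s => _) = if N k == 0 then cst 0 else fun s => g * u s k 0).
    case: ifP => _; first exact: measurable_cst.
    by apply: measurable_funM; [exact: measurable_cst | exact: hu.1].
  by apply/funext => s; rewrite !mxE; case: ifP => _; rewrite ?mulr0.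
split=> //; apply: integrable_lty => //.
have iu := @integrableZl _ _ _ mu _ (measurable_itv _) (g ^+ 2) _ (in_L2_integrable hu).
apply: le_integrable iu => //.
  by apply/measurable_EFinP; exact: measurable_norm2_sqr mgu.
move=> s _ /=; rewrite lee_fin ger0_norm ?sqr_ge0//.
rewrite (ger0_norm (mulr_ge0 (sqr_ge0 _) (sqr_ge0 _))) !norm2_sqr mulr_sumr.
apply: ler_sum => k _; rewrite !mxE.
by case: ifP => _; [rewrite !mulr0 -!expr2 mulr_ge0 ?sqr_ge0 | rewrite expr2 mulrACA].
Qed.

(** Provides the functions [alpha] and [beta] for Gronwall, bounded uniformly in time by the full
    integral. *)
Lemma is_primitive_L2 n (f : R -> 'cV[R]_n) : in_L2 f ->
  exists2 F : R -> R, is_primitive F (fun s => norm2 (f s) ^+ 2) &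
    forall t, 0 <= t -> 0 <= F t <= L2norm f ^+ 2.
Proof.
move=> /in_L2_integrable fi.
have fit t : mu.-integrable `[0, t] (EFin \o (fun s => norm2 (f s) ^+ 2)).
  by apply: integrableS fi => //; apply: subset_itvl; rewrite bnd_simp.
exists (fun t => \int[mu]_(s in `[0, t]) (norm2 (f s) ^+ 2)) => t t0 //.
rewrite Rintegral_ge0 => [|s _]; last exact: sqr_ge0.
rewrite sqr_sqrtr; last by apply: Rintegral_ge0 => s _; exact: sqr_ge0.
rewrite fine_le//; try exact: integrable_fin_num.
apply: ge0_subset_integral => //.
- by case/integrableP : fi.
- by move=> s _; rewrite lee_fin sqr_ge0.
- by apply: subset_itvl; rewrite bnd_simp.
Qed.

End Energy.

(** * The bound on the components of the state *)

Theorem proposition3p3 (R : realType) (n m : nat)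
  (A : 'M[R]_n) (N : 'I_m -> 'M[R]_n) (B : 'M[R]_(n, m))
  (hA : hurwitz A)
  (u : R -> 'cV[R]_m) (hu : in_L2 u)
  (gamma : R) (hgamma : 0 < gamma)
  (hstab : hurwitz (tensmx A 1%:M + tensmx 1%:M A
                    + gamma ^- 2 *: \sum_(k < m) tensmx (N k) (N k)))
  (xB : R -> 'cV[R]_n) (hxB : bilinear_solution A B N u 0 xB)
  (PB : 'M[R]_n) (hPB : posdef PB)
  (hLMI : loewner_le
            (A^T *m invmx PB + invmx PB *m A
             + gamma ^- 2 *: \sum_(k < m) (N k)^T *m invmx PB *m N k)
            (- (invmx PB *m B *m B^T *m invmx PB)))
  (p : 'I_n -> 'cV[R]_n) (hp : orthonormal_basis p)
  (lambda : 'I_n -> R) (hlambda : forall i, PB *m p i = lambda i *: p i)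
  (i : 'I_n) :
  (ereal_sup [set `|dot (xB t) (p i)|%:E | t in `[0%R, +oo[]
   <= (Num.sqrt (lambda i) * L2norm u
       * expR (2^-1 * L2norm (fun s => gamma *: active_control N u s) ^+ 2))%:E)%E.
Proof.
have hQ := posdef_inv hPB; set Q := invmx PB in hLMI hQ.
have sQ := symmetricmx_tr hQ.1.
pose f t := bilinear_rhs A B N (xB t) (u t).
have xf j : is_primitive (fun t => xB t j 0) (fun t => f t j 0).
  by move=> t t0; have [ft ->] := hxB t j t0; rewrite mxE add0r.
have Vw := is_primitive_quad Q xf.
have [alpha alphaP alphaB] := is_primitive_L2 hu.
have [beta betaP betaB] := is_primitive_L2 (in_L2_active N gamma hu).
have gron t : 0 <= t -> dot (xB t) (Q *m xB t) <= alpha t * expR (beta t).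
  apply: gronwall Vw alphaP betaP _ _ _ => s _; try exact: sqr_ge0.
  (* By symmetry of [Q] the two halves of the energy density coincide, giving the factor [2] of the
     dissipation inequality. *)
  rewrite {1}(dot_mulmx Q) sQ.
  have := lmi_dissipation u s (xB s) (lt0r_neq0 hgamma) hQ hLMI.
  by rewrite dot_mulmx sQ mulr_natl mulr2n.
apply: ge_ereal_sup => _ [t /= + <-]; rewrite in_itv/= andbT => t0.
rewrite lee_fin.
have [||l0 xpl] := @dot_eigenvector_le _ _ PB (lambda i) (xB t) (p i) hPB.
- exact: hlambda.
- by rewrite hp.2 eqxx.
have rhs0 : 0 <= Num.sqrt (lambda i) * L2norm u *
    expR (2^-1 * L2norm (fun s => gamma *: active_control N u s) ^+ 2).
  by rewrite !mulr_ge0 ?sqrtr_ge0 ?expR_ge0.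
(* Both sides are nonnegative, so their squares are compared; squaring removes the root of the
   eigenvalue and the one half in the exponent. *)
rewrite -(ler_pXn2r (n := 2)) ?nnegrE// real_normK ?num_real//.
apply: le_trans xpl _.
rewrite !exprMn sqr_sqrtr ?(ltW l0)// -mulrA ler_wpM2l ?(ltW l0)//.
apply: le_trans (gron t t0) _.
have /andP[a0 aL] := alphaB t t0; have /andP[_ bL] := betaB t t0.
have -> y : expR (2^-1 * y) ^+ 2 = expR y :> R.
  by rewrite expr2 -expRD; congr expR; field.
by rewrite ler_pM ?ler_expR ?expR_ge0.
Qed.
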